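(* Let $G$ be a finite simple graph, let $v$ be an articulation (cut vertex) of $G$, and let $H$ and $K$ be subgraphs of $G$ with $G=H\cup K$ and $H\cap K=(\{v\},\emptyset)$. Then, writing $Q(\cdot)$ for $Q(\cdot;x,y)$, \[ Q(G)=Q(H-v)\,Q(K-v)+\frac{1}{xy}\left[Q(H)-Q(H-v)\right]\left[Q(K)-Q(K-v)\right]. \]
   Context: For a finite simple graph $G=(V,E)$, $Q(G;x,y)=\sum_{X\subseteq V}x^{|X|}y^{k(G[X])}$, where $G[X]$ is the induced subgraph and $k$ the number of connected components (the null graph has $k=0$). An articulation is a vertex whose removal increases the number of components. $H-v$ denotes removal of $v$ and its incident edges. *)

(* Defs.v *)
From mathcomp Require Import all_boot all_order all_algebra.
From mathcomp Require Import fraction.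
From mathcomp Require Import mpoly.

Set Implicit Arguments.
Unset Strict Implicit.
Unset Printing Implicit Defensive.

Import GRing.Theory.
Local Open Scope ring_scope.

Section Graphs.
Variable T : finType.
Implicit Types (X V : {set T}) (E : {set {set T}}) (u v : T).

Definition simple_edges V E : bool :=
  [forall e in E, (e \subset V) && (#|e| == 2)%N].

(* The vertices form an arbitrary subset of the ambient type [T]; an edge is a
   two-element set of vertices.  Since the axiom is boolean, graphs are equal
   as soon as their vertex sets and edge sets are. *)
Record sgraph := SGraph {
  vset : {set T};
  eset : {set {set T}};
  sgraph_axiom : simple_edges vset eset
}.

Implicit Types G H K : sgraph.

Lemma simple_edgesP V E :
  reflect (forall e, e \in E -> e \subset V /\ #|e| = 2%N) (simple_edges V E).
Proof.
apply: (iffP forall_inP) => VE e /VE; first by case/andP=> -> /eqP.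
by case=> -> ->.
Qed.

Definition subgraph H G : bool :=
  (vset H \subset vset G) && (eset H \subset eset G).

Fact gunion_axiom H K :
  simple_edges (vset H :|: vset K) (eset H :|: eset K).
Proof.
apply/simple_edgesP=> e; rewrite inE => /orP[] eE.
- have [sV cE] := simple_edgesP _ _ (sgraph_axiom H) e eE.
  by split=> //; apply: subset_trans sV (subsetUl _ _).
- have [sV cE] := simple_edgesP _ _ (sgraph_axiom K) e eE.
  by split=> //; apply: subset_trans sV (subsetUr _ _).
Qed.

Definition gunion H K : sgraph := SGraph (gunion_axiom H K).

Fact ginter_axiom H K :
  simple_edges (vset H :&: vset K) (eset H :&: eset K).
Proof.
apply/simple_edgesP=> e; rewrite inE => /andP[eH eK].
have [sH cE] := simple_edgesP _ _ (sgraph_axiom H) e eH.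
have [sK _] := simple_edgesP _ _ (sgraph_axiom K) e eK.
by rewrite subsetI sH sK.
Qed.

Definition ginter H K : sgraph := SGraph (ginter_axiom H K).

Fact edgeless_axiom X : simple_edges X set0.
Proof. by apply/simple_edgesP=> e; rewrite inE. Qed.

Definition edgeless X : sgraph := SGraph (edgeless_axiom X).

Fact induced_axiom G X :
  simple_edges (vset G :&: X) [set e in eset G | e \subset X].
Proof.
apply/simple_edgesP=> e; rewrite inE => /andP[eG sX].
have [sG cE] := simple_edgesP _ _ (sgraph_axiom G) e eG.
by rewrite subsetI sG sX.
Qed.

(* [G[X]]; it is only used for [X \subset vset G]. *)
Definition induced G X : sgraph := SGraph (induced_axiom G X).

Fact gdel_axiom G v :
  simple_edges (vset G :\ v) [set e in eset G | v \notin e].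
Proof.
apply/simple_edgesP=> e; rewrite inE => /andP[eG ve].
have [sG cE] := simple_edgesP _ _ (sgraph_axiom G) e eG.
by rewrite subsetD1 sG ve.
Qed.

Definition gdel G v : sgraph := SGraph (gdel_axiom G v).

Definition adj G : rel T := [rel u w | [set u; w] \in eset G].

Definition ncomp G : nat := n_comp (adj G) (vset G).

Definition articulation G v : bool :=
  (v \in vset G) && (ncomp G < ncomp (gdel G v))%N.

Definition Xvar : {mpoly int[2]} := 'X_ord0.
Definition Yvar : {mpoly int[2]} := 'X_ord_max.

Definition Qpoly G : {mpoly int[2]} :=
  \sum_(X : {set T} | X \subset vset G)
    Xvar ^+ #|X| * Yvar ^+ ncomp (induced G X).

(* [Q(G; x, y)] in the field of fractions of [Z[x, y]], where [x y] is
   invertible. *)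
Definition Q G : {fraction {mpoly int[2]}} := tofrac (Qpoly G).

End Graphs.

Definition xF : {fraction {mpoly int[2]}} := tofrac Xvar.
Definition yF : {fraction {mpoly int[2]}} := tofrac Yvar.

(* Main.v *)
Require Import Defs.
From mathcomp Require Import all_boot all_order all_algebra.
From mathcomp Require Import fraction mpoly.

(** Vertex sets [X] of [gunion H K] correspond to pairs of vertex sets of [H]
    and [K] that agree on the intersection of [H] and [K].  Gluing [H[X]] and
    [K[X]] along at most one vertex loses exactly as many components, and as
    many vertices, as there are shared vertices.  So the subsets avoiding [v]
    contribute [Q (H - v) * Q (K - v)], and [x * y] times the sum over those
    containing [v] is the product of the corresponding sums for [H] and [K]. *)

Set Implicit Arguments.
Unset Strict Implicit.
Unset Printing Implicit Defensive.

Import GRing.Theory.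
Local Open Scope ring_scope.

Section Components.
Variable T : finType.
Implicit Types (G H K : sgraph T) (X : {set T}) (u v w x y : T).

Lemma sgraph_eq G H : vset G = vset H -> eset G = eset H -> G = H.
Proof.
case: G H => [V E ax] [V' E' ax'] /= eV eE.
by case: _ / eV ax'; case: _ / eE => ax'; rewrite (bool_irrelevance ax ax').
Qed.

Lemma gunionC H K : gunion H K = gunion K H.
Proof. by apply: sgraph_eq; exact: setUC. Qed.

Lemma adj_vset G u w : adj G u w -> (u \in vset G) && (w \in vset G).
Proof.
move=> /(simple_edgesP _ _ (sgraph_axiom G))[sV _].
by rewrite !(subsetP sV) // !inE eqxx ?orbT.
Qed.

Lemma adj_connect_sym G : connect_sym (adj G).
Proof. by apply: sym_connect_sym => u w; rewrite /adj /= setUC. Qed.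

Lemma adj_rootP G x y :
  reflect (fingraph.root (adj G) x = fingraph.root (adj G) y)
          (connect (adj G) x y).
Proof. exact: fingraph.rootP (adj_connect_sym G) _ _. Qed.

Lemma closed_vset G : closed (adj G) (vset G).
Proof. by move=> u w /adj_vset/andP[-> ->]. Qed.

(** Writing components as an image of the vertex set makes the cardinality laws for unions and
    intersections available. *)
Lemma ncomp_roots G : ncomp G = #|[set fingraph.root (adj G) x | x in vset G]|.
Proof.
rewrite /ncomp /n_comp_mem -cardsE; apply: eq_card => x.
rewrite !inE; apply/andP/imsetP=> [[/eqP rx xV] | [z zV ->]].
  by exists x.
rewrite roots_root; last exact: adj_connect_sym.
by rewrite -(closed_connect (@closed_vset G) (connect_root _ z)).
Qed.

Lemma connect_gunionl H K x y :
  connect (adj H) x y -> connect (adj (gunion H K)) x y.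
Proof.
apply: connect_sub => u w uw; apply: connect1.
by rewrite /adj /= inE [_ \in _]uw.
Qed.

(* Collapsing [K] to [v] maps every path of the union to a path of [H].  The
   vertex [v] need not be shared: if [H] and [K] are disjoint, it is arbitrary. *)
Lemma connect_gunion_retract H K v x y :
    vset H :&: vset K \subset [set v] ->
    connect (adj (gunion H K)) x y ->
  connect (adj H) (if x \in vset H then x else v)
                  (if y \in vset H then y else v).
Proof.
move=> sv /connectP[p]; elim: p x => [|z p IHp] x /=; first by move=> _ ->.
case/andP=> xz zp yE; apply: connect_trans (IHp _ zp yE) => {p y zp yE IHp}.
move: xz; rewrite /adj /= inE => /orP[xz | /adj_vset/andP[xK zK]].
  by have /andP[-> ->] := adj_vset xz; apply: connect1.
(* An edge of [K] contracts to the single point [v], because a vertex of [K] that also lies in [H]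
   must be [v]. *)
have toV w : w \in vset K -> (if w \in vset H then w else v) = v.
  move=> wK; case: ifP => // wH.
  by apply/set1P/(subsetP sv); rewrite inE wH.
by rewrite !toV.
Qed.

Lemma connect_gunion_inl H K v x y :
    vset H :&: vset K \subset [set v] -> x \in vset H -> y \in vset H ->
  connect (adj (gunion H K)) x y = connect (adj H) x y.
Proof.
move=> sv xH yH; apply/idP/idP; last exact: connect_gunionl.
by move/(connect_gunion_retract sv); rewrite xH yH.
Qed.

Lemma connect_gunion_cross H K v x y :
    vset H :&: vset K \subset [set v] -> x \in vset H -> y \in vset K ->
  connect (adj (gunion H K)) x y -> connect (adj H) x v.
Proof.
move=> sv xH yK /(connect_gunion_retract sv); rewrite xH.
case: ifP => // yH; suff /set1P-> : y \in [set v] by [].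
by apply: (subsetP sv); rewrite inE yH.
Qed.

(** Adding [K] merges no two components of [H], so the root map of the union is injective on the
    roots of [H]. *)
Lemma card_gunion_rootsl H K v :
    vset H :&: vset K \subset [set v] ->
  #|[set fingraph.root (adj (gunion H K)) x | x in vset H]| = ncomp H.
Proof.
move=> sv; set r := fingraph.root _; rewrite ncomp_roots.
have -> : [set r x | x in vset H] =
    [set r x | x in fingraph.root (adj H) @: vset H].
  rewrite -imset_comp; apply: eq_in_imset => x xH.
  rewrite /r /=; apply/adj_rootP/connect_gunionl.
  exact: connect_root.
apply: card_in_imset => _ _ /imsetP[x xH ->] /imsetP[y yH ->].
have rH z : z \in vset H -> fingraph.root (adj H) z \in vset H.
  by rewrite -(closed_connect (@closed_vset H) (connect_root _ z)).
move=> /adj_rootP.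
rewrite (connect_gunion_inl sv) ?rH // => /adj_rootP.
by rewrite !root_root; try exact: adj_connect_sym.
Qed.

(** Inclusion-exclusion on the roots reached from [H] and from [K]: the roots in both images are
    those of the shared vertices. *)
Lemma ncomp_gunion H K v :
    vset H :&: vset K \subset [set v] ->
  (ncomp (gunion H K) + #|vset H :&: vset K| = ncomp H + ncomp K)%N.
Proof.
move=> sv; have svC : vset K :&: vset H \subset [set v] by rewrite setIC.
rewrite -(card_gunion_rootsl sv) -(card_gunion_rootsl svC) (gunionC K).
rewrite ncomp_roots /=; set r := fingraph.root _; rewrite -[RHS]cardsUI -imsetU.
congr (_ + _)%N.
(* With at most one shared vertex, [r] is injective on the intersection. *)
rewrite -(card_in_imset (f := r)); last first.
  by move=> x y /(subsetP sv)/set1P-> /(subsetP sv)/set1P->.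
congr #|pred_of_set _|; apply/eqP.
rewrite eqEsubset subsetI !imsetS ?subsetIl ?subsetIr //=.
(* A path of the union from [x] in [H] to [y] in [K] forces both to be connected to [v], so [v] is
   shared and has the same root. *)
apply/subsetP=> _ /setIP[/imsetP[x xH ->] /imsetP[y yK]].
move=> /adj_rootP xy.
have xv := connect_gunion_cross sv xH yK xy.
have yv : connect (adj K) y v.
  apply: (connect_gunion_cross svC yK xH).
  by rewrite gunionC adj_connect_sym.
apply/imsetP; exists v.
  rewrite inE -(closed_connect (@closed_vset H) xv) xH.
  by rewrite -(closed_connect (@closed_vset K) yv).
by apply/adj_rootP/connect_gunionl.
Qed.

Lemma induced_gunion H K X :
  induced (gunion H K) X = gunion (induced H X) (induced K X).
Proof.
apply: sgraph_eq => /=; first exact: setIUl.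
by apply/setP=> e; rewrite !inE andb_orl.
Qed.

Lemma induced_setI G X : induced G (X :&: vset G) = induced G X.
Proof.
apply: sgraph_eq => /=; first by rewrite setICA setIid setIC.
apply/setP=> e; rewrite !inE subsetI; case eG: (e \in eset G) => //=.
by have [-> _] := simple_edgesP _ _ (sgraph_axiom G) e eG; rewrite andbT.
Qed.

Lemma induced_gdel G v X : v \notin X -> induced (gdel G v) X = induced G X.
Proof.
move=> vX; apply: sgraph_eq => /=.
  rewrite setIDAC; apply/setDidPl.
  by rewrite disjoint_sym disjoints1 inE (negPf vX) andbF.
apply/setP=> e; rewrite !inE -andbA; congr (_ && _).
by apply: andb_idl => /subsetP eX; apply: contra vX => /eX.
Qed.

Lemma gdel_gunion H K v :
  gdel (gunion H K) v = gunion (gdel H v) (gdel K v).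
Proof.
apply: sgraph_eq => /=; first exact: setDUl.
by apply/setP=> e; rewrite !inE andb_orl.
Qed.

End Components.

Section Polynomial.
Variable T : finType.
Implicit Types (G H K : sgraph T) (W X : {set T}) (v : T).

Definition Qterm G X : {mpoly int[2]} :=
  Xvar ^+ #|X| * Yvar ^+ ncomp (induced G X).

(** [W] stands for the shared vertices, so that one gluing formula serves both [set0] and
    [[set v]]. *)
Definition Qpoly_over G W : {mpoly int[2]} :=
  \sum_(X : {set T} | (X \subset vset G) && (W \subset X)) Qterm G X.

Lemma Qpoly_over0 G : Qpoly_over G set0 = Qpoly G.
Proof. by apply: eq_bigl => X; rewrite sub0set andbT. Qed.

Lemma Qpoly_split G v : Qpoly G = Qpoly_over G [set v] + Qpoly (gdel G v).
Proof.
rewrite /Qpoly (bigID (fun X : {set T} => v \in X)) /=; congr (_ + _).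
  by apply: eq_bigl => X; rewrite sub1set.
apply: eq_big => [X | X /andP[_ vX]]; first by rewrite subsetD1.
by rewrite induced_gdel.
Qed.

(** The shared vertices are counted twice on the right, in the sizes and in the numbers of
    components; the power of [Xvar * Yvar] compensates for both. *)
Lemma Qterm_gunion H K v X :
    vset H :&: vset K \subset [set v] -> X \subset vset H :|: vset K ->
    vset H :&: vset K \subset X ->
  (Xvar * Yvar) ^+ #|vset H :&: vset K| * Qterm (gunion H K) X =
  Qterm H (X :&: vset H) * Qterm K (X :&: vset K).
Proof.
move=> sv sX WX.
have cX : (#|X :&: vset H| + #|X :&: vset K| =
           #|vset H :&: vset K| + #|X|)%N.
  by rewrite -cardsUI -setIUr (setIidPl sX) -setIIr (setIidPr WX) addnC.
have iW : vset (induced H X) :&: vset (induced K X) = vset H :&: vset K.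
  by rewrite /= -setIIl (setIidPl WX).
have := @ncomp_gunion _ (induced H X) (induced K X) v.
rewrite iW => /(_ sv) cG.
rewrite /Qterm !induced_setI mulrACA -!exprD cX -cG induced_gunion.
by rewrite exprMn mulrACA -!exprD [in RHS]addnC (addnC (ncomp _)) (addnC #|X|).
Qed.

Lemma Qpoly_over_gunion H K v :
    vset H :&: vset K \subset [set v] ->
    let W := vset H :&: vset K in
  (Xvar * Yvar) ^+ #|W| * Qpoly_over (gunion H K) W =
  Qpoly_over H W * Qpoly_over K W.
Proof.
move=> sv W; rewrite /Qpoly_over big_distrlr pair_big mulr_sumr /=.
rewrite (reindex_onto (fun X => (X :&: vset H, X :&: vset K))
                      (fun AB => AB.1 :|: AB.2)) /=; last first.
  (* Whatever [B] adds inside [V] lies in [V :&: V'], hence already in [A]. *)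
  have glue (V V' A B : {set T}) : A \subset V -> B \subset V' ->
      V :&: V' \subset A -> (A :|: B) :&: V = A.
    move=> AV BV WA; rewrite setIUl (setIidPl AV); apply/setUidPl.
    by apply: subset_trans WA; rewrite setIC setIS.
  case=> A B /= /andP[/andP[AH WA] /andP[BK WB]]; congr (_, _).
    exact: glue AH BK WA.
  by rewrite setUC; apply: glue BK AH _; rewrite setIC.
apply: eq_big => [X | X /andP[sX WX]]; last exact: (Qterm_gunion sv).
(* The round-trip condition of the reindexing amounts to [X] lying in the union of the vertex
   sets. *)
rewrite !subsetIr !subsetI subsetIl subsetIr !andbT andbb -setIUr andbC.
by congr (_ && _); apply/setIidPl/eqP.
Qed.

End Polynomial.

Lemma mulXY_neq0 : Xvar * Yvar != 0.
Proof. by rewrite mulf_neq0 // -msize_poly_eq0 msizeX. Qed.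

Theorem theorem6p1 (T : finType) (G H K : sgraph T) (v : T)
    (hv : articulation G v)
    (hH : subgraph H G) (hK : subgraph K G)
    (hU : G = gunion H K)
    (hI : ginter H K = edgeless [set v]) :
  Q G = Q (gdel H v) * Q (gdel K v)
        + 1 / (xF * yF) * (Q H - Q (gdel H v)) * (Q K - Q (gdel K v)).
Proof.
have HKv : vset H :&: vset K = [set v] by have := congr1 (@vset T) hI.
(* Once [v] is deleted the two sides are disjoint, so the factor is [(Xvar * Yvar) ^+ 0]. *)
have del : Qpoly (gdel G v) = Qpoly (gdel H v) * Qpoly (gdel K v).
  have := @Qpoly_over_gunion _ (gdel H v) (gdel K v) v.
  rewrite -gdel_gunion -hU /= -setDIl HKv setDv sub0set => /(_ isT).
  by rewrite cards0 expr0 mul1r !Qpoly_over0.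
have over : Xvar * Yvar * Qpoly_over G [set v] =
            Qpoly_over H [set v] * Qpoly_over K [set v].
  have := @Qpoly_over_gunion _ H K v.
  by rewrite -hU /= HKv cards1 expr1 subxx; apply.
have split (L : sgraph T) :
    Q L - Q (gdel L v) = tofrac (Qpoly_over L [set v]).
  by rewrite /Q (Qpoly_split L v) tofracD addrK.
(* [Q G] is split into the sets containing [v] and those avoiding it. *)
rewrite -(subrK (Q (gdel G v)) (Q G)) !split addrC /Q del tofracM.
congr (_ + _); rewrite -mulrA -[X in _ * X]tofracM -over tofracM.
by rewrite -[xF * yF]tofracM mul1r mulKf // tofrac_eq0 mulXY_neq0.
Qed.
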